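(* Let $G=(V,E)$ be a finite loopless multigraph and let $(L,C)$ be a derangement assignment on $G$. Suppose there exists a biorientation $D$ of $G$ such that (i) the biorientation of $G_S$ induced by $D$ is kernel-perfect, (ii) $E_T(G)\subseteq E_{D2}(G)$, and (iii) $|L(v)|\geq d^+_D(v)+1$ for each $v\in V$. Then $G$ is $(L,C)$-colorable.
   Context: Graphs are finite loopless multigraphs; digraphs are finite loopless multidigraphs. A biorientation of $G$ is a digraph $D$ on $V(G)$ in which each edge $e=\{u,v\}$ of $G$ is replaced by the arc $(u,v)$, the arc $(v,u)$, or both (and there are no other arcs). $E_{D2}(G)$ is the set of edges of $G$ that are oriented in both directions in $D$. $d^+_D(v)$ is the out-degree of $v$ in $D$ (counting arcs with multiplicity). For $H$ a spanning subgraph of $G$, the biorientation of $H$ induced by $D$ is the subdigraph of $D$ consisting of the arcs coming from edges of $H$. A kernel of a digraph is an independent set $U$ of vertices such that every vertex $v\notin U$ has an arc $(v,u)$ to some $u\in U$; a digraph is kernel-perfect if every induced subdigraph has a kernel. A correspondence assignment $(L,C)$ for $G$ consists of lists $L(v)$ for $v\in V$ and, for each edge $e=\{u,v\}$, a partial matching $C_e$ between $\{u\}\times L(u)$ and $\{v\}\times L(v)$. An $(L,C)$-coloring is a function $\varphi$ with $\varphi(v)\in L(v)$ for all $v$ such that for every edge $e=\{u,v\}$, $(u,\varphi(u))$ and $(v,\varphi(v))$ are not matched in $C_e$; $G$ is $(L,C)$-colorable if one exists. An edge $e=\{u,v\}$ is straight if $\{(u,c_1),(v,c_2)\}\in C_e$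 implies $c_1=c_2$, and twisted otherwise. $E_S(G)$, $E_T(G)$ are the sets of straight and twisted edges, $G_S=(V,E_S(G))$, $G_T=(V,E_T(G))$. $C_e$ (for $e=\{v,w\}$) is a partial derangement if $\{(v,c),(w,c)\}\notin C_e$ for all $c\in L(v)\cap L(w)$. $(L,C)$ is a derangement assignment if $C_e$ is a partial derangement for every twisted edge $e$. *)

(* Defs.v *)
From mathcomp Require Import all_boot.
From mathcomp Require Import boolp classical_sets functions cardinality.
Set Implicit Arguments.
Unset Strict Implicit.
Unset Printing Implicit Defensive.

Record multigraph := Multigraph {
  vertex : finType;
  edge : finType;
  ends : edge -> {set vertex};
  card_ends : forall e, #|ends e| = 2 }.

Section SpanningSubgraph.
Variables (G : multigraph) (F : {set edge G}).

Definition sub_edge : finType := {e : edge G | e \in F}.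
Definition sub_ends (e : sub_edge) : {set vertex G} := ends (val e).

Lemma card_sub_ends (e : sub_edge) : #|sub_ends e| = 2.
Proof. exact: card_ends. Qed.

Definition spanning_subgraph : multigraph := Multigraph card_sub_ends.
End SpanningSubgraph.

Record digraph := Digraph {
  dvertex : finType;
  arc : finType;
  tail : arc -> dvertex;
  head : arc -> dvertex;
  loopless : forall a, tail a != head a }.

Definition outdeg (D : digraph) (v : dvertex D) : nat :=
  #|[set a : arc D | tail a == v]|.

Section InducedSubdigraph.
Variables (D : digraph) (X : {set dvertex D}).

Definition ind_vertex : finType := {v : dvertex D | v \in X}.
Definition ind_arc : finType :=
  {a : arc D | (tail a \in X) && (head a \in X)}.

Lemma ind_tail_in (a : ind_arc) : tail (val a) \in X.
Proof. by case/andP: (valP a). Qed.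

Lemma ind_head_in (a : ind_arc) : head (val a) \in X.
Proof. by case/andP: (valP a). Qed.

Definition ind_tail (a : ind_arc) : ind_vertex :=
  exist _ (tail (val a)) (ind_tail_in a).
Definition ind_head (a : ind_arc) : ind_vertex :=
  exist _ (head (val a)) (ind_head_in a).

Lemma ind_loopless (a : ind_arc) : ind_tail a != ind_head a.
Proof. by rewrite -val_eqE /= loopless. Qed.

Definition induced_subdigraph : digraph := Digraph ind_loopless.
End InducedSubdigraph.

Definition independent (D : digraph) (U : {set dvertex D}) : Prop :=
  forall a : arc D, ~ (tail a \in U /\ head a \in U).

Definition is_kernel (D : digraph) (U : {set dvertex D}) : Prop :=
  independent U /\
  forall v, v \notin U -> exists a : arc D, tail a = v /\ head a \in U.

Definition kernel_perfect (D : digraph) : Prop :=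
  forall X : {set dvertex D},
    exists U : {set dvertex (induced_subdigraph X)}, is_kernel U.

(* [orient e] is the nonempty set of the directions (tail, head) given to the
   edge [e]; recording it edge by edge keeps parallel edges apart. *)
Record biorientation (G : multigraph) := Biorientation {
  orient : edge G -> {set vertex G * vertex G};
  orient_ends : forall e p, p \in orient e -> ends e = [set p.1; p.2];
  orient_neq0 : forall e, orient e != finset.set0 }.

Section BiorientationDigraph.
Variables (G : multigraph) (D : biorientation G).

Definition bior_arc : finType :=
  {x : edge G * (vertex G * vertex G) | x.2 \in orient D x.1}.

Lemma bior_loopless (a : bior_arc) : (val a).2.1 != (val a).2.2.
Proof.
have := card_ends (val a).1.
by rewrite (orient_ends (valP a)) cards2; case: eqP.
Qed.

Definition bior_digraph : digraph :=
  @Digraph (vertex G) bior_arc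
    (fun a => (val a).2.1) (fun a => (val a).2.2) bior_loopless.

Definition edges_both : {set edge G} :=
  [set e | [forall u, forall v, (ends e == [set u; v]) ==>
    ((u, v) \in orient D e) && ((v, u) \in orient D e)]].

Variable F : {set edge G}.

Definition ind_orient (e : edge (spanning_subgraph F)) := orient D (val e).

Lemma ind_orient_ends (e : edge (spanning_subgraph F)) p :
  p \in ind_orient e -> ends e = [set p.1; p.2].
Proof. exact: orient_ends. Qed.

Lemma ind_orient_neq0 (e : edge (spanning_subgraph F)) :
  ind_orient e != finset.set0.
Proof. exact: orient_neq0. Qed.

Definition induced_bior : biorientation (spanning_subgraph F) :=
  Biorientation ind_orient_ends ind_orient_neq0.
End BiorientationDigraph.

(* The unordered pair {(u,c1), (v,c2)} belongs to the matching of [e] iff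
   [matched e (u, c1) (v, c2)], whence the symmetry.  Lists are arbitrary
   subsets of the type [K] of colors and need not be finite. *)
Record correspondence (G : multigraph) (K : Type) := Correspondence {
  clist : vertex G -> set K;
  matched : edge G -> vertex G * K -> vertex G * K -> Prop;
  matched_sym : forall e x y, matched e x y -> matched e y x;
  matched_ends : forall e x y, matched e x y -> ends e = [set x.1; y.1];
  matched_clist : forall e x y, matched e x y -> clist x.1 x.2;
  matched_inj : forall e x y z, matched e x y -> matched e x z -> y = z }.

Section Correspondence.
Variables (G : multigraph) (K : Type) (LC : correspondence G K).

Definition is_coloring (phi : vertex G -> K) : Prop :=
  (forall v, clist LC v (phi v)) /\
  forall e u v, ends e = [set u; v] ->
    ~ matched LC e (u, phi u) (v, phi v).

Definition colorable : Prop := exists phi, is_coloring phi.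

Definition straight (e : edge G) : Prop :=
  forall u v c1 c2, matched LC e (u, c1) (v, c2) -> c1 = c2.

Definition straight_edges : {set edge G} := [set e | `[< straight e >]].
Definition twisted_edges : {set edge G} := [set e | `[< ~ straight e >]].

Definition partial_derangement (e : edge G) : Prop :=
  forall v w c, ends e = [set v; w] -> clist LC v c -> clist LC w c ->
    ~ matched LC e (v, c) (w, c).

Definition derangement_assignment : Prop :=
  forall e, e \in twisted_edges -> partial_derangement e.
End Correspondence.

(* Main.v *)
(** Color one color at a time.  For a color c occurring in some list, let X be
    the set of uncolored vertices whose list contains c, and give c to a kernel
    U of the straight digraph on X: no straight edge joins two vertices of U,
    and twisted edges never match c with c.  A vertex v outside U loses the color
    c only if v is in X, in which case it has a straight arc to U; it loses any
    other color only through a twisted edge to U, and that edge is an arc from v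
    since it is oriented both ways.  Hence v loses at most as many colors as it
    has arcs to U, and the list condition survives the deletion of U. *)
Require Import Defs.
From mathcomp Require Import all_boot.
From mathcomp Require Import boolp classical_sets functions cardinality.
Import Defs.

(** No [a] in [A] serves two elements, so the witness chosen for the head of [s] can be removed from
    [A] without harming the tail. *)
Lemma uniq_size_le_card (K : eqType) (T : finType) (s : seq K) (A : {set T})
    (R : K -> T -> Prop) :
  uniq s ->
  (forall k, k \in s -> exists2 a, a \in A & R k a) ->
  (forall k l a, a \in A -> R k a -> R l a -> k = l) ->
  size s <= #|A|.
Proof.
elim: s A => [//|k s IH] A /= /andP[ks us] exR injR.
have [a aA Rka] := exR k (mem_head _ _).
rewrite (cardsD1 a) aA add1n ltnS.
apply: IH => // [l ls|l m b /setD1P[_ bA]]; last exact: injR.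
have [|b bA Rlb] := exR l; first by rewrite inE ls orbT.
exists b => //; rewrite !inE bA andbT; apply/eqP => ba.
move: ks; rewrite (injR k l a) ?ls //; by rewrite -ba.
Qed.

(** Lists may be infinite; this cuts them down to finite sequences, on which colors can be
    counted. *)
Lemma card_geP_uniq (K : eqType) (n : nat) (A : set K) :
  (`I_n #<= A)%card ->
  exists s : seq K, [/\ uniq s, size s = n & forall k, k \in s -> A k].
Proof.
move=> /card_leP[f].
have ltI (i : 'I_n) : val i \in (`I_n)%classic by rewrite mem_set /=.
pose g (i : 'I_n) := val (f (SigSub (ltI i))).
exists (codom g); split; last by move=> _ /codomP[i ->]; apply/set_mem/valP.
- rewrite map_inj_uniq ?enum_uniq // => i j /val_inj fij; apply/val_inj.
  by have /(congr1 val) := @inj _ _ _ f _ _ (in_setT _) (in_setT _) fij.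
- by rewrite size_codom card_ord.
Qed.

Lemma kernel_perfect_on (D : digraph) (X : {set dvertex D}) :
  kernel_perfect D ->
  exists U : {set dvertex D}, [/\ U \subset X, independent U &
    forall v, v \in X -> v \notin U ->
      exists a : arc D, tail a = v /\ head a \in U].
Proof.
move=> /(_ X)[U [indU domU]].
have memU (x : dvertex (induced_subdigraph X)) :
    (val x \in [set val y | y in U]) = (x \in U).
  exact: mem_imset val_inj.
exists [set val x | x in U]; split.
- by apply/fintype.subsetP => _ /imsetP[x _ ->]; exact: valP.
- move=> a [ta ha].
  have aX : (tail a \in X) && (head a \in X).
    by apply/andP; split; [case/imsetP: ta|case/imsetP: ha] => x _ ->; exact: valP.
  apply: (indU (exist _ a aX)); split; by rewrite -memU.
- move=> v vX; rewrite (memU (exist _ v vX)) => /domU[a [av aU]].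
  exists (val a); split; first by rewrite -[v]/(val (exist (fun v => v \in X) v vX)) -av.
  by rewrite -(memU (head a)) in aU.
Qed.

Section Coloring.
Variables (G : multigraph) (K : eqType) (LC : correspondence G K).
Variables (D : biorientation G) (S : {set edge G}).
Hypothesis kerS : kernel_perfect (bior_digraph (induced_bior D S)).
Hypothesis straightS : forall e, e \in S -> straight LC e.
Hypothesis derangedS : forall e v w c,
  e \notin S -> ~ matched LC e (v, c) (w, c).
Hypothesis bothS : forall e, e \notin S -> e \in edges_both D.

Definition arc_edge (a : arc (bior_digraph D)) : edge G := (val a).1.

Definition out_arcs (W : {set vertex G}) (v : vertex G) :
    {set arc (bior_digraph D)} :=
  [set a : arc (bior_digraph D) | (tail a == v) && (head a \in W)].

Lemma straight_kernel (X : {set vertex G}) :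
  exists U : {set vertex G}, [/\ U \subset X,
    forall e u v, e \in S -> ends e = [set u; v] -> u \in U -> v \notin U &
    forall v, v \in X -> v \notin U ->
      exists2 a, a \in out_arcs U v & arc_edge a \in S].
Proof.
have [U [UX indU domU]] := kernel_perfect_on (bior_digraph (induced_bior D S)) X kerS.
exists U; split=> // [e u v eS euv uU|v vX vU].
  (* Any direction [p] of [e] gives an arc between [u] and [v], hence inside [U], against
     independence. *)
  apply/negP => vU; have /set0Pn[p pe] := orient_neq0 D e.
  have /setP euvp : [set u; v] = [set p.1; p.2].
    by rewrite -euv; exact: orient_ends pe.
  pose e' : edge (spanning_subgraph S) := exist _ e eS.
  have pe' : (e', p).2 \in orient (induced_bior D S) (e', p).1 by [].
  apply: (indU (exist _ (e', p) pe')) => /=; split.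
    by move: (euvp p.1); rewrite !inE eqxx => /orP[]/eqP->.
  by move: (euvp p.2); rewrite !inE eqxx orbT => /orP[]/eqP->.
have [[[e p] pe] [/= av aU]] := domU v vX vU.
have pe' : (val e, p).2 \in orient D (val e, p).1 by [].
exists (exist _ (val e, p) pe'); last exact: valP.
by rewrite inE /= av eqxx.
Qed.

(** Each lost color is charged to its own arc from [v] to [U]: the color [c] to an arc over [S], any
    other to an arc over a twisted edge. *)
Lemma killed_colors_le (U : {set vertex G}) (v : vertex G) (c : K) (s : seq K) :
  uniq s ->
  (c \in s -> exists2 a, a \in out_arcs U v & arc_edge a \in S) ->
  (forall k, k \in s -> exists e u, u \in U /\ matched LC e (v, k) (u, c)) ->
  size s <= #|out_arcs U v|.
Proof.
move=> us cs killed.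
(* An arc determines the color charged to it: [c] over [S], and elsewhere the unique partner of
   [(head a, c)]. *)
pose R k (a : arc (bior_digraph D)) := if arc_edge a \in S then k = c
  else matched LC (arc_edge a) (v, k) (head a, c).
apply: (@uniq_size_le_card _ _ _ _ R) => // [k ks|k l a aU].
  have [kc|/eqP kc] := eqVneq k c.
    have [|a aU aS] := cs; first by rewrite -kc.
    by exists a => //; rewrite /R aS.
  have [e [u [uU m]]] := killed k ks.
  have eS : e \notin S by apply/negP => /straightS /(_ _ _ _ _ m).
  have vue : (e, (v, u)).2 \in orient D (e, (v, u)).1.
    move: (bothS e eS); rewrite inE => /forallP/(_ v)/forallP/(_ u).
    by rewrite (matched_ends m) eqxx => /andP[].
  exists (exist _ (e, (v, u)) vue); first by rewrite inE /= eqxx.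
  by rewrite /R /= (negPf eS).
rewrite /R; case: ifP => _; first by move=> -> ->.
by move=> /matched_sym mk /matched_sym /(matched_inj mk)[].
Qed.

(** Induction on the size of [W], the set of uncolored vertices; [k0] is a default value when [W] is
    empty. *)
Lemma list_coloring_on (k0 : K) (W : {set vertex G})
    (L : vertex G -> seq K) :
  (forall v, v \in W -> uniq (L v)) ->
  (forall v, v \in W -> #|out_arcs W v| < size (L v)) ->
  exists phi : vertex G -> K, (forall v, v \in W -> phi v \in L v) /\
    forall e u v, u \in W -> v \in W -> ~ matched LC e (u, phi u) (v, phi v).
Proof.
have [n] := ubnP #|W|; elim: n W L => // n IH W L.
rewrite ltnS => Wn uniqL sizeL.
have [->|[v0 v0W]] := finset.set_0Vmem W.
  by exists (fun=> k0); split=> [v|e u v]; rewrite inE.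
have : 0 < size (L v0) by exact: leq_ltn_trans (sizeL v0 v0W).
case Lv0 : (L v0) => [//|c s0] _.
have [U [UX indU domU]] := straight_kernel [set v in W | c \in L v].
have UW v : v \in U -> v \in W /\ c \in L v.
  by move/(fintype.subsetP UX); rewrite inE => /andP[].
(* The induction needs [U] nonempty: [v0] lies in [U] or has an arc into it. *)
have [u0 u0U] : exists u, u \in U.
  have [v0U|v0U] := boolP (v0 \in U); first by exists v0.
  have [|a] := domU v0 _ v0U; first by rewrite inE v0W Lv0 mem_head.
  by rewrite inE => /andP[_ aU] _; exists (head a).
pose killed v k := `[< exists e u, u \in U /\ matched LC e (v, k) (u, c) >].
pose L' v := [seq k <- L v | ~~ killed v k].
have [| | |phi [phiL phiM]] := IH (W :\: U) L'.
- apply: leq_trans Wn; apply: proper_card; apply/properP; split.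
    exact: finset.subsetDl.
  by exists u0; [case: (UW u0 u0U) | rewrite inE u0U].
- by move=> v /setDP[vW _]; rewrite filter_uniq ?uniqL.
- move=> v /setDP[vW vU].
  have le_killed : size [seq k <- L v | killed v k] <= #|out_arcs U v|.
    apply: (@killed_colors_le _ _ c) => [|cs|k].
    + by rewrite filter_uniq ?uniqL.
    + by apply: domU vU; move: cs; rewrite mem_filter inE vW => /andP[].
    + by rewrite mem_filter => /andP[/asboolP].
  (* The list of [v] loses at most the first summand, so what is left still exceeds the second. *)
  have split_arcs : #|out_arcs W v| = #|out_arcs U v| + #|out_arcs (W :\: U) v|.
    rewrite -(cardsID [set a : arc (bior_digraph D) | head a \in U] (out_arcs W v)).
    congr (_ + _); apply: eq_card => a; rewrite !inE.
      case: (boolP (head a \in U)) => [/UW[-> _]|_]; by rewrite ?andbF ?andbT.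
    by rewrite andbCA.
  have := sizeL v vW; rewrite split_arcs.
  rewrite -(count_predC (killed v) (L v)) -!size_filter => lt_sum.
  rewrite -(ltn_add2l #|out_arcs U v|); apply: leq_trans lt_sum _.
  by rewrite leq_add2r.
exists (fun v => if v \in U then c else phi v); split=> [v vW|e u v uW vW].
  case: ifPn => vU; first by case: (UW v vU).
  by have := phiL v; rewrite inE vU vW mem_filter => /(_ isT)/andP[].
have unmatched w x : w \in W -> w \notin U -> x \in U ->
    ~ matched LC e (w, phi w) (x, c).
  move=> wW wU xU m; have := phiL w; rewrite inE wU wW mem_filter.
  by move=> /(_ isT)/andP[/asboolP[]]; exists e, x.
(* Inside [U] both ends have color [c]: independence handles [S], the derangement the other edges.
   Across [U], conflicting colors were deleted. *)
case: ifPn => uU; case: ifPn => vU.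
- have [eS m|eS] := boolP (e \in S); last exact: derangedS.
  by have /negP := indU e u v eS (matched_ends m) uU.
- by move=> /matched_sym; exact: unmatched.
- exact: unmatched.
- by apply: phiM; rewrite inE ?uU ?vU.
Qed.
End Coloring.

Theorem theorem3p1 (G : multigraph) (K : Type) (LC : correspondence G K)
    (D : biorientation G) :
  derangement_assignment LC ->
  kernel_perfect (bior_digraph (induced_bior D (straight_edges LC))) ->
  twisted_edges LC \subset edges_both D ->
  (forall v : vertex G,
     (`I_((outdeg (D := bior_digraph D) v) + 1)%N #<= clist LC v)%card) ->
  colorable LC.
Proof.
move=> derLC kerD bothD largeL.
have twisted e : e \notin straight_edges LC -> e \in twisted_edges LC.
  by rewrite !inE => /asboolPn.
(* [{classic K}] equips the arbitrary type [K] with decidable equality. *)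
have /choice[L LP] v := @card_geP_uniq {classic K} _ _ (largeL v).
(* [K] may be empty when there are no vertices; otherwise the nonempty list of [v0] supplies the
   default color. *)
case: (pickP (fun _ : vertex G => true)) => [v0 _|noV]; last first.
  have phi : vertex G -> K by move=> v; have := noV v.
  by exists phi; split=> [v|e v]; have := noV v.
have [_ + _] := LP v0; case: (L v0) => [|k0 _ _]; first by rewrite addn1.
have [| | | | |phi [phiL phiM]] := @list_coloring_on G {classic K} LC D
    (straight_edges LC) kerD _ _ _ k0 [set: vertex G] L.
- by move=> e; rewrite inE => /asboolP.
- move=> e v w c /twisted eT m.
  exact: (derLC e eT v w c (matched_ends m) (matched_clist m)
    (matched_clist (matched_sym m)) m).
- by move=> e /twisted; exact: (fintype.subsetP bothD).
- by move=> v _; case: (LP v).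
- move=> v _; have [_ -> _] := LP v; rewrite addn1 ltnS subset_leq_card //.
  by apply/fintype.subsetP => a; rewrite !inE => /andP[].
exists phi; split=> [v|e u v _]; last by apply: phiM; rewrite inE.
by have [_ _] := LP v; apply; apply: phiL; rewrite inE.
Qed.
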